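(* Fix an integer $k>1$ and, for each $n\ge 1$, let $S$ be the bidirectional spider graph with $k$ legs each of length $n$ and all weights equal. Then $\operatorname{ept}_{\mathrm{rzf}}(S)=2n(1+o(1))$, where the $o(1)$ is with respect to $n\to\infty$ (with $k$ fixed).
   Context: The spider with $k$ legs of length $n$ is the tree consisting of a center $c$ and $k$ disjoint paths $v_{i,1},\dots,v_{i,n}$ ($1\le i\le k$), where $v_{i,1}$ is adjacent to $c$; bidirectional means each undirected edge is replaced by two directed edges in opposite directions. All weights equal means every directed edge has the same positive weight. Randomized zero forcing (RZF): $G$ is a finite directed graph with nonnegative weights $w_{uv}$ on directed edges $(u,v)$, with $w_{uv}=0$ if there is no edge from $u$ to $v$. Start with blue set $B_0$. Given the blue set $B_t$, each white vertex $w\notin B_t$ independently becomes blue at round $t+1$ with probability $p_t(w)=\frac{\sum_{u\in B_t}w_{uw}}{\sum_{u\in V(G)}w_{uw}}$ if the denominator is positive, and $p_t(w)=0$ otherwise; blue vertices stay blue forever. For $v\in V(G)$, $\operatorname{ept}_{\mathrm{rzf}}(G,v)$ is the expected value of $\tau=\min\{t: B_t=V(G)\}$ started from $B_0=\{v\}$ if coloring all of $G$ is possible, and $\infty$ otherwise. $\operatorname{ept}_{\mathrm{rzf}}(G)=\min_{v\in V(G)}\operatorname{ept}_{\mathrm{rzf}}(G,v)$. *)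

(* Defs.v *)
From HB Require Import structures.
From mathcomp Require Import all_boot all_order all_algebra.
From mathcomp Require Import all_classical all_reals all_analysis.

Set Implicit Arguments.
Unset Strict Implicit.
Unset Printing Implicit Defensive.

Import Order.TTheory GRing.Theory Num.Theory.
Import numFieldNormedType.Exports.

Local Open Scope classical_set_scope.
Local Open Scope ring_scope.

Record wdigraph (R : realType) := WDigraph {
  vert : finType;
  edge : rel vert;
  weight : vert -> vert -> R;
  weight_ge0 : forall u v, 0 <= weight u v;
  weight_nonedge : forall u v, ~~ edge u v -> weight u v = 0 }.

Section RandomizedZeroForcing.
Context {R : realType} (G : wdigraph R).
Local Notation V := (vert G).

(* Probability that w is blue at the next round, given the blue set B. *)
Definition blue_prob (B : {set V}) (w : V) : R :=
  if w \in B then 1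
  else if 0 < \sum_(u : V) weight u w
  then (\sum_(u in B) weight u w) / \sum_(u : V) weight u w
  else 0.

(* The product expresses that, given B, the vertices are coloured
   independently; blue vertices stay blue because blue_prob is then 1. *)
Definition rzf_step (B B' : {set V}) : R :=
  \prod_(w : V) (if w \in B' then blue_prob B w else 1 - blue_prob B w).

(* The probability that B_0 = b 0, ..., B_t = b t, for the chain started
   at B0. *)
Definition rzf_traj (B0 : {set V}) (t : nat)
    (b : {ffun 'I_t.+1 -> {set V}}) : R :=
  (b ord0 == B0)%:R *
  \prod_(s < t) rzf_step (b (widen_ord (leqnSn t) s)) (b (lift ord0 s)).

(* P(tau = t), where tau is the first t such that B_t is the vertex set. *)
Definition rzf_tau (B0 : {set V}) (t : nat) : R :=
  \sum_(b : {ffun 'I_t.+1 -> {set V}} |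
         (b ord_max == [set: V]%SET)
         && [forall s : 'I_t, b (widen_ord (leqnSn t) s) != [set: V]%SET])
    rzf_traj B0 b.

(* When colouring G is possible, tau is almost surely finite, so that its
   expectation is the sum of t * P(tau = t). *)
Definition ept_rzf_from (v : V) : \bar R :=
  if `[< exists t, 0 < rzf_tau [set v]%SET t >]
  then (\sum_(0 <= t <oo) (t%:R * rzf_tau [set v]%SET t)%:E)%E
  else +oo%E.

Definition ept_rzf : \bar R := \big[mine/+oo%E]_(v : V) ept_rzf_from v.

End RandomizedZeroForcing.

(* None is the center c and Some (i, j) is v_{i+1,j+1}. *)
Definition spider_vert (k n : nat) : finType := option ('I_k * 'I_n)%type.

(* The undirected edges of the spider, each oriented away from the center. *)
Definition spider_out (k n : nat) : rel (spider_vert k n) := fun u v =>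
  match u, v with
  | None, Some (_, j) => j == 0%N :> nat
  | Some (i, j), Some (i', j') => (i == i') && (j' == j.+1 :> nat)
  | _, None => false
  end.

Definition spider_edge (k n : nat) : rel (spider_vert k n) := fun u v =>
  spider_out u v || spider_out v u.

Section Spider.
Context {R : realType} (k n : nat) (c : {posnum R}).

Definition spider_weight (u v : spider_vert k n) : R :=
  if spider_edge u v then c%:num else 0.

Lemma spider_weight_ge0 u v : 0 <= spider_weight u v.
Proof. by rewrite /spider_weight; case: ifP. Qed.

Lemma spider_weight_nonedge u v :
  ~~ spider_edge u v -> spider_weight u v = 0.
Proof. by rewrite /spider_weight => /negbTE ->. Qed.

Definition spider : wdigraph R :=
  WDigraph spider_weight_ge0 spider_weight_nonedge.

End Spider.

(* Main.v *)
(* Started at the center, colouring a leg is a race in which each new vertex costs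
   a geometric time of mean 2. If w_i is the number of vertices of leg i beyond
   its initial blue segment, then for a > 1 the sum of a ^ w_i over the legs that
   are not yet blue shrinks in mean by the factor (1 + 1/a) / 2 at each round, so
   P(tau > t) <= k a^n ((1 + 1/a) / 2)^t. With a = 1 + d this is negligible beyond
   t = 2 (1 + d) n, and summing P(tau > t) gives the upper bound.
   For the lower bound, any starting vertex leaves a leg entirely white, as k > 1.
   The farthest blue vertex of that leg advances by at most one per round, and
   with probability at most 1/2 until the last vertex of the leg, so that
   2 (n - 1 - m), m being its distance to the center, decreases in mean by at
   most 1 per round: the expected time is at least 2 n - 2. Turning P(tau > t)
   into the series of t P(tau = t) needs T P(tau > T) -> 0, for which a crude
   geometric bound from every starting vertex is enough. *)
Require Import Defs.
From HB Require Import structures.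
From mathcomp Require Import all_boot all_order all_algebra.
From mathcomp Require Import all_classical all_reals all_analysis.
From mathcomp Require Import ring lra zify.
Import Order.TTheory GRing.Theory Num.Theory.
Import numFieldNormedType.Exports.
Local Open Scope classical_set_scope.
Local Open Scope ring_scope.

(** * One round: the transition probabilities between blue sets *)

Section OneRound.
Context {R : realType} {G : wdigraph R}.
Local Notation V := (vert G).
Implicit Types (B C : {set V}) (w : V).

Lemma blue_prob_ge0 B w : 0 <= blue_prob B w.
Proof.
rewrite /blue_prob; case: ifP => // _; case: ifP => // s_gt0.
by apply: divr_ge0; [apply: sumr_ge0 => u _; apply: weight_ge0 | exact: ltW].
Qed.

Lemma blue_prob_le1 B w : blue_prob B w <= 1.
Proof.
rewrite /blue_prob; case: ifP => // _; case: ifP => // s_gt0.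
rewrite ler_pdivrMr // mul1r [leRHS](bigID (mem B)) /= lerDl.
by apply: sumr_ge0 => u _; apply: weight_ge0.
Qed.

Lemma rzf_step_ge0 B C : 0 <= rzf_step B C.
Proof.
apply: prodr_ge0 => w _; case: ifP => _; first exact: blue_prob_ge0.
by rewrite subr_ge0 blue_prob_le1.
Qed.

(** Expanding the product of [p + (1 - p)] over all vertices gives one term for each possible next
    blue set. *)
Lemma sum_rzf_step B : \sum_C rzf_step B C = 1.
Proof.
have <- : \prod_w (blue_prob B w + (1 - blue_prob B w)) = 1.
  by apply: big1 => w _; rewrite subrKC.
by rewrite bigA_distr; apply: eq_bigl.
Qed.

Lemma sum_rzf_step_mem B w :
  \sum_(C : {set V} | w \in C) rzf_step B C = blue_prob B w.
Proof.
(* In the same expansion, a zero in place of the factor for [w] staying white kills every set that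
   omits [w]. *)
pose q u := if u == w then 0 else 1 - blue_prob B u.
have <- : \prod_u (blue_prob B u + q u) = blue_prob B w.
  rewrite (bigD1 w) //= [q w]/q eqxx addr0 big1 ?mulr1 // => u /negbTE uw.
  by rewrite /q uw subrKC.
rewrite bigA_distr [RHS](bigID (fun C : {set V} => w \in C)) /=.
rewrite [X in _ + X]big1 ?addr0; last first.
  by move=> C /negbTE wC; rewrite (bigD1 w) //= wC /q eqxx mul0r.
apply: eq_big => [C //|C wC]; apply: eq_bigr => u _; case: ifP => // uC.
by rewrite /q; case: eqP => // uw; rewrite -uw uC in wC.
Qed.

Lemma rzf_step_neq0_sub B C : rzf_step B C != 0 -> B \subset C.
Proof.
apply: contraNT => /subsetPn[w wB /negbTE wC]; apply/eqP.
by rewrite /rzf_step (bigD1 w) //= wC /blue_prob wB subrr mul0r.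
Qed.

Lemma rzf_step_neq0_adj B C w : rzf_step B C != 0 -> w \in C -> w \notin B ->
  exists2 u, u \in B & weight u w != 0.
Proof.
move=> step wC wB; apply: contrapT => nadj; move: step; apply/negP/negPn/eqP.
have in0 : \sum_(u in B) weight u w = 0.
  by apply: big1 => u uB; apply/eqP/negPn/negP => wu; apply: nadj; exists u.
rewrite /rzf_step (bigD1 w) //= wC /blue_prob (negbTE wB) in0.
by rewrite mul0r if_same mul0r.
Qed.

(** Every drift estimate below follows a single vertex [w]. The mean is at most [(1 - p) x + p y],
    written so that a bound on [p] can be inserted directly. *)
Lemma rzf_step_mean_le B w (f : {set V} -> R) (x y : R) :
  (forall C, rzf_step B C != 0 -> w \notin C -> f C <= x) ->
  (forall C, rzf_step B C != 0 -> w \in C -> f C <= y) ->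
  \sum_C rzf_step B C * f C <= x - blue_prob B w * (x - y).
Proof.
move=> fx fy.
have -> : x - blue_prob B w * (x - y) =
    \sum_C rzf_step B C * (x - (w \in C)%:R * (x - y)).
  under eq_bigr do rewrite mulrBr.
  rewrite sumrB -mulr_suml sum_rzf_step mul1r -sum_rzf_step_mem mulr_suml.
  congr (_ - _); rewrite big_mkcond; apply: eq_bigr => C _.
  by case: ifP; rewrite ?(mul1r, mul0r, mulr0).
apply: ler_sum => C _; have [->|step] := eqVneq (rzf_step B C) 0.
  by rewrite !mul0r.
apply: ler_wpM2l; first exact: rzf_step_ge0.
case: (boolP (w \in C)) => wC; rewrite ?mul1r ?mul0r ?subr0 ?subKr; last exact: fx.
exact: fy.
Qed.

End OneRound.

(** * First-step recursion for the law of the colouring time *)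

Section ColouringTime.
Context {R : realType} {G : wdigraph R}.
Local Notation V := (vert G).
Implicit Types (B C : {set V}).

Lemma rzf_tau_ge0 B t : 0 <= rzf_tau B t.
Proof.
apply: sumr_ge0 => b _; apply: mulr_ge0 => //; apply: prodr_ge0 => s _.
exact: rzf_step_ge0.
Qed.

Lemma rzf_tau0 B : rzf_tau B 0 = (B == [set: V]%SET)%:R.
Proof.
rewrite /rzf_tau (reindex (fun C => [ffun _ : 'I_1 => C])); last first.
  apply: onW_bij; exists (fun b : {ffun 'I_1 -> {set V}} => b ord0) => [C|b].
    by rewrite ffunE.
  by apply/ffunP => i; rewrite ffunE (ord1 i).
under eq_bigl => C.
  rewrite ffunE; have -> : [forall s : 'I_0, [ffun=> C] (widen_ord (leqnSn 0) s)
     != [set: V]%SET] by apply/forallP; case.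
  rewrite andbT; over.
by rewrite big_pred1_eq /rzf_traj big_ord0 mulr1 ffunE eq_sym.
Qed.

(** Prepends a state to a trajectory; this bijection lets the first round be split off. *)
Definition ffun_cons t (p : {set V} * {ffun 'I_t.+1 -> {set V}}) :
    {ffun 'I_t.+2 -> {set V}} :=
  [ffun i => if unlift ord0 i is Some j then p.2 j else p.1].

Lemma ffun_cons0 t p : ffun_cons t p ord0 = p.1.
Proof. by rewrite ffunE unlift_none. Qed.

Lemma ffun_consS t p j : ffun_cons t p (lift ord0 j) = p.2 j.
Proof. by rewrite ffunE liftK. Qed.

Lemma ffun_cons_bij t : bijective (ffun_cons t).
Proof.
exists (fun b : {ffun 'I_t.+2 -> {set V}} =>
  (b ord0, [ffun j : 'I_t.+1 => b (lift ord0 j)])) => [[C b]|b] /=.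
  congr pair; first exact: ffun_cons0.
  by apply/ffunP => j; rewrite ffunE ffun_consS.
apply/ffunP => i; case: (unliftP ord0 i) => [j ->|->].
  by rewrite ffun_consS ffunE.
by rewrite ffun_cons0.
Qed.

Lemma rzf_tauS B t : rzf_tau B t.+1 =
  if B == [set: V]%SET then 0 else \sum_C rzf_step B C * rzf_tau C t.
Proof.
rewrite /rzf_tau (reindex (ffun_cons t)); last exact/onW_bij/ffun_cons_bij.
pose full t (b : {ffun 'I_t.+1 -> {set V}}) :=
  (b ord_max == [set: V]%SET) &&
  [forall s : 'I_t, b (widen_ord (leqnSn t) s) != [set: V]%SET].
have widen0 : widen_ord (leqnSn t.+1) ord0 = ord0 by apply: val_inj.
have widenS (s : 'I_t) : widen_ord (leqnSn t.+1) (lift ord0 s) =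
  lift ord0 (widen_ord (leqnSn t) s) by apply: val_inj.
have fullE p : full t.+1 (ffun_cons t p) = (p.1 != [set: V]%SET) && full t p.2.
  rewrite /full andbCA; congr andb.
    by rewrite (_ : ord_max = lift ord0 ord_max) ?ffun_consS //; apply: val_inj.
  apply/forallP/andP => [all_p|[p1 /forallP p2] s].
    split; first by have := all_p ord0; rewrite widen0 ffun_cons0.
    by apply/forallP => s; have := all_p (lift ord0 s); rewrite widenS ffun_consS.
  case: (unliftP ord0 s) => [j|] ->; last by rewrite widen0 ffun_cons0.
  by rewrite widenS ffun_consS.
have trajE p : rzf_traj B (ffun_cons t p) =
    (p.1 == B)%:R * (rzf_step p.1 (p.2 ord0) * rzf_traj (p.2 ord0) p.2).
  rewrite /rzf_traj ffun_cons0 eqxx mul1r big_ord_recl widen0 ffun_cons0.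
  rewrite ffun_consS; congr (_ * (_ * _)); apply: eq_bigr => s _.
  by rewrite widenS !ffun_consS.
rewrite (eq_bigl _ _ fullE) (eq_bigr _ (fun p _ => trajE p)) /=.
rewrite -(pair_big_dep (fun C => C != [set: V]%SET) (fun _ b => full t b)
  (fun C b => (C == B)%:R * (rzf_step C (b ord0) * rzf_traj (b ord0) b))) /=.
case: (eqVneq B) => [->|nB].
  rewrite big1 // => C /negbTE nC; rewrite big1 // => b _.
  by rewrite nC mul0r.
rewrite (bigD1 B) //= [X in _ + X]big1 ?addr0; last first.
  by move=> C /andP[_ /negbTE nC]; rewrite big1 // => b _; rewrite nC mul0r.
under eq_bigr do rewrite eqxx mul1r.
under [RHS]eq_bigr do rewrite mulr_sumr.
rewrite exchange_big /=; apply: eq_bigr => b _.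
(* [rzf_traj C b] contains the indicator of [b ord0 == C], so only one [C] survives. *)
rewrite (bigD1 (b ord0)) //= big1 ?addr0 // => C /negbTE nC.
by rewrite /rzf_traj eq_sym nC mul0r mulr0.
Qed.

End ColouringTime.

(** * Tail probabilities and drift bounds for them *)

Section Tail.
Context {R : realType} {G : wdigraph R}.
Local Notation V := (vert G).
Implicit Types (B C : {set V}) (v : V) (t T : nat).

(** This is P(tau > t), with the event that tau is infinite included. *)
Definition rzf_tail B t : R := 1 - \sum_(s < t.+1) rzf_tau B s.

Lemma rzf_tail_step B t : rzf_tau B t.+1 = rzf_tail B t - rzf_tail B t.+1.
Proof. by rewrite /rzf_tail (big_ord_recr t.+1) /=; ring. Qed.

Lemma rzf_tail0 B : rzf_tail B 0 = (B != [set: V]%SET)%:R.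
Proof.
rewrite /rzf_tail big_ord_recl big_ord0 addr0 rzf_tau0.
by case: eqP; rewrite ?subrr ?subr0.
Qed.

Lemma rzf_tailS B t : rzf_tail B t.+1 =
  if B == [set: V]%SET then 0 else \sum_C rzf_step B C * rzf_tail C t.
Proof.
rewrite /rzf_tail big_ord_recl rzf_tau0.
under eq_bigr do rewrite rzf_tauS.
case: (eqVneq B) => _; first by rewrite big1 // addr0 subrr.
rewrite add0r exchange_big /= -{1}(sum_rzf_step B) -sumrB.
by apply: eq_bigr => C _; rewrite mulrBr mulr1 mulr_sumr.
Qed.

Lemma rzf_tail_full t : rzf_tail [set: V]%SET t = 0.
Proof. by case: t => [|t]; rewrite ?rzf_tail0 ?rzf_tailS eqxx. Qed.

Lemma rzf_tail_ge0 B t : 0 <= rzf_tail B t.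
Proof.
elim: t B => [|t IH] B; first by rewrite rzf_tail0.
rewrite rzf_tailS; case: ifP => // _; apply: sumr_ge0 => C _.
by apply: mulr_ge0 => //; exact: rzf_step_ge0.
Qed.

Lemma rzf_tail_le1 B t : rzf_tail B t <= 1.
Proof. by rewrite gerBl; apply: sumr_ge0 => s _; exact: rzf_tau_ge0. Qed.

(** Summation by parts, each P(tau = t) being a difference of consecutive tails. *)
Lemma sum_mul_rzf_tau B T : \sum_(t < T.+1) t%:R * rzf_tau B t =
  \sum_(t < T) rzf_tail B t - T%:R * rzf_tail B T.
Proof.
elim: T => [|T IH]; first by rewrite big_ord_recl !big_ord0 !mul0r addr0 subrr.
rewrite big_ord_recr /= IH rzf_tail_step [in RHS]big_ord_recr /=.
by rewrite -natr1; ring.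
Qed.

(** Markov's inequality: [f] dominates the indicator of not being finished and contracts in mean by
    [r]. Sets without [v] never occur, since blue vertices stay blue. *)
Lemma rzf_tail_decay v (f : {set V} -> R) (r : R) : 0 <= r ->
  (forall C, 0 <= f C) ->
  (forall C, v \in C -> C != [set: V]%SET -> 1 <= f C) ->
  (forall C, v \in C -> C != [set: V]%SET ->
    \sum_D rzf_step C D * f D <= r * f C) ->
  forall t B, v \in B -> rzf_tail B t <= r ^+ t * f B.
Proof.
move=> r0 f0 f1 fr; elim=> [|t IH] B vB.
  by rewrite rzf_tail0 mul1r; case: eqVneq => [_|nB] /=; [exact: f0|exact: f1].
rewrite rzf_tailS; case: eqVneq => [_|nB].
  by apply: mulr_ge0; [exact: exprn_ge0 | exact: f0].
apply: (@le_trans _ _ (\sum_C rzf_step B C * (r ^+ t * f C))).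
  apply: ler_sum => C _; have [->|step] := eqVneq (rzf_step B C) 0.
    by rewrite !mul0r.
  apply: ler_wpM2l; first exact: rzf_step_ge0.
  apply: IH; exact: (fintype.subsetP (rzf_step_neq0_sub _ _ step)) vB.
under eq_bigr do rewrite mulrCA.
rewrite -mulr_sumr exprSr -mulrA; apply: ler_wpM2l; first exact: exprn_ge0.
exact: fr.
Qed.

(** Optional stopping at min(tau, T), whose mean is the sum of the tails. On tau > T the remaining
    value of [h] is at most [M]; otherwise it is at most 0. *)
Lemma le_sum_rzf_tail (h : {set V} -> R) (M : R) :
  (forall C, h C <= M) -> h [set: V]%SET <= 0 ->
  (forall C, C != [set: V]%SET -> h C - 1 <= \sum_D rzf_step C D * h D) ->
  forall T B, h B <= \sum_(t < T) rzf_tail B t + M * rzf_tail B T.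
Proof.
move=> hM hfull hstep; elim=> [|T IH] B; have [->|nB] := eqVneq B [set: V]%SET.
- by rewrite big_ord0 rzf_tail_full mulr0 addr0.
- by rewrite big_ord0 rzf_tail0 nB mulr1 add0r.
- by rewrite big1 ?rzf_tail_full ?mulr0 ?addr0 // => t _; rewrite rzf_tail_full.
rewrite big_ord_recl rzf_tail0 nB -addrA -lerBlDl.
apply: (le_trans (hstep _ nB)).
under [X in _ <= X + _]eq_bigr => t _ do rewrite rzf_tailS (negbTE nB).
rewrite exchange_big rzf_tailS (negbTE nB) mulr_sumr -big_split /=.
apply: ler_sum => C _; rewrite mulrCA -mulr_sumr -mulrDr.
by apply: ler_wpM2l; [exact: rzf_step_ge0 | exact: IH].
Qed.

(** The potential is 2 to the number of white vertices. With probability at least [q] some vertex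
    turns blue and the potential is at least halved, whence the factor [1 - q / 2]. *)
Lemma rzf_tail_geometric v (q : R) : 0 <= q <= 1 ->
  (forall C, v \in C -> C != [set: V]%SET ->
    exists2 w, w \notin C & q <= blue_prob C w) ->
  forall t B, v \in B -> rzf_tail B t <= (1 - q / 2) ^+ t * 2 ^+ #|V|.
Proof.
move=> /andP[q0 q1] qP t B vB.
pose f C : R := if C == [set: V]%SET then 0 else 2 ^+ #|~: C|.
have f0 C : 0 <= f C by rewrite /f; case: ifP => // _; exact: exprn_ge0.
have fle C : f C <= 2 ^+ #|~: C| by rewrite /f; case: ifP => // _; exact: exprn_ge0.
have r0 : 0 <= 1 - q / 2 by lra.
apply: (@le_trans _ _ ((1 - q / 2) ^+ t * f B)); last first.
  apply: ler_wpM2l; first exact: exprn_ge0.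
  by apply: (le_trans (fle _)); rewrite ler_eXn2l ?ltr1n // max_card.
apply: (@rzf_tail_decay v) => // C vC nC.
  by rewrite /f (negbTE nC) exprn_ege1 // ler1n.
have [w wC qw] := qP C vC nC.
have f2 : 0 <= f C / 2 by have := f0 C; lra.
apply: (@le_trans _ _ (f C - blue_prob C w * (f C - f C / 2))); last first.
  have : 0 <= (blue_prob C w - q) * (f C / 2) by apply: mulr_ge0; lra.
  by lra.
apply: rzf_step_mean_le.
  move=> D /rzf_step_neq0_sub CD _; apply: (le_trans (fle _)).
  by rewrite /f (negbTE nC) ler_eXn2l ?ltr1n // subset_leq_card // finset.setCS.
move=> D /rzf_step_neq0_sub CD wD; apply: (le_trans (fle _)).
rewrite /f (negbTE nC) ler_pdivlMr // -exprSr ler_eXn2l ?ltr1n //.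
apply: proper_card; rewrite fintype.properE finset.setCS CD; apply/subsetPn.
by exists w; rewrite finset.in_setC ?wD.
Qed.

End Tail.

(** * From tail sums to the expected time *)

Section ExpectedTime.
Context {R : realType} {G : wdigraph R}.
Local Notation V := (vert G).
Implicit Types (C : {set V}) (v : V) (t T : nat).

Lemma ept_rzf_from_le v (x : R) :
  (forall T, \sum_(t < T) rzf_tail [set v]%SET t <= x) ->
  (ept_rzf_from v <= x%:E)%E.
Proof.
move=> tailx; rewrite /ept_rzf_from; case: asboolP => [_|tau0].
  apply: lime_le.
    apply: is_cvg_nneseries => t _ _; rewrite lee_fin mulr_ge0 //.
    exact: rzf_tau_ge0.
  near=> n; rewrite sumEFin lee_fin big_mkord; case: {+}n => [|T].
    by have := tailx 0%N; rewrite !big_ord0.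
  rewrite sum_mul_rzf_tau; apply: le_trans (tailx T).
  by rewrite gerBl mulr_ge0 // rzf_tail_ge0.
(* If colouring were impossible all tails would be 1, and their sums could not stay below [x]. *)
have tail1 t : rzf_tail [set v]%SET t = 1.
  rewrite /rzf_tail big1 ?subr0 // => s _; apply/eqP.
  rewrite eq_le rzf_tau_ge0 andbT leNgt; apply/negP => tau_gt0.
  by apply: tau0; exists s.
have := tailx (Num.bound x).
under eq_bigr do rewrite tail1.
rewrite sumr_const card_ord leNgt archi_boundP //.
by have := tailx 0%N; rewrite big_ord0.
Unshelve. all: by end_near.
Qed.

(** Each of the [t] terms of 1 + s + ... + s^(t-1) is at least s^t, and their sum is at most 1 / (1
    - s). *)
Lemma natr_mul_exp_le (s : R) t : 0 <= s < 1 -> t%:R * s ^+ t <= (1 - s)^-1.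
Proof.
move=> /andP[s0 s1]; have s1' : 0 < 1 - s by rewrite subr_gt0.
rewrite -[leRHS]mul1r ler_pdivlMr //.
suff : t%:R * s ^+ t * (1 - s) <= 1 - s ^+ t.
  by move=> /le_trans; apply; rewrite gerBl exprn_ge0.
elim: t => [|t IH]; first by rewrite !mul0r expr0 subrr.
have : 0 <= (1 - s) * (1 - s ^+ t.+1).
  by rewrite mulr_ge0 ?subr_ge0 ?exprn_ile1 // ltW.
have := ler_wpM2l s0 IH; rewrite -natr1 !exprS; lra.
Qed.

Lemma ept_rzf_from_ge v (h : {set V} -> R) (M r K : R) :
  0 <= r < 1 -> (forall t, rzf_tail [set v]%SET t <= r ^+ t * K) ->
  (forall C, h C <= M) -> h [set: V]%SET <= 0 ->
  (forall C, C != [set: V]%SET -> h C - 1 <= \sum_D rzf_step C D * h D) ->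
  ((h [set v]%SET)%:E <= ept_rzf_from v)%E.
Proof.
move=> /andP[r0 r1] tailr hM hfull hstep.
rewrite /ept_rzf_from; case: asboolP => [_|_]; last exact: leey.
have K0 : 0 <= K.
  by have := tailr 0%N; rewrite mul1r; apply: le_trans; exact: rzf_tail_ge0.
apply/lee_subgt0Pr => e e0; rewrite -EFinB.
(* Cutting the series at [T] loses at most [(M + T) P(tau > T)]. In r^T = s^T s^T one factor absorbs
   [T] and the other tends to 0. *)
pose s := Num.sqrt r.
have s0 : 0 <= s by exact: sqrtr_ge0.
have s1 : s < 1 by rewrite -sqrtr1 ltr_sqrt.
have s01 : 0 <= s < 1 by rewrite s0.
have rE t : r ^+ t = s ^+ t * s ^+ t by rewrite -exprMn -expr2 sqr_sqrtr.
have [T sT] : exists T, (`|M| + (1 - s)^-1) * K * s ^+ T < e.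
  have ns1 : `|s| < 1 by rewrite ger0_norm.
  have /cvgrPdist_lt/(_ e e0)[T _ /(_ T (leqnn T))] :=
    cvg_geometric ((`|M| + (1 - s)^-1) * K) ns1.
  rewrite sub0r normrN => /(le_lt_trans (ler_norm _)) sT; by exists T.
apply: le_trans (nneseries_lim_ge T.+1 _); last first.
  by move=> t _ _; rewrite lee_fin mulr_ge0 // rzf_tau_ge0.
rewrite sumEFin lee_fin big_mkord sum_mul_rzf_tau.
have := le_sum_rzf_tail _ _ hM hfull hstep T [set v]%SET.
suff : (M + T%:R) * rzf_tail [set v]%SET T <= e by lra.
apply: le_trans (ltW sT).
apply: (@le_trans _ _ ((`|M| + T%:R) * (r ^+ T * K))).
  apply: (@le_trans _ _ ((`|M| + T%:R) * rzf_tail [set v]%SET T)).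
    by apply: ler_wpM2r; [exact: rzf_tail_ge0 | rewrite lerD2r ler_norm].
  by apply: ler_wpM2l => //; apply: addr_ge0.
have sT0 : 0 <= s ^+ T by exact: exprn_ge0.
rewrite rE -mulrA [X in _ <= _ * X]mulrC.
have -> : (`|M| + T%:R) * (s ^+ T * s ^+ T * K) =
  (`|M| * s ^+ T + T%:R * s ^+ T) * (s ^+ T * K) by ring.
rewrite ler_wpM2r ?mulr_ge0 // lerD ?natr_mul_exp_le //.
by rewrite ler_piMr // exprn_ile1 // ltW.
Qed.

End ExpectedTime.

(** * The spider with legs of length [n.+1]: neighbours and blue probabilities *)

Section Spider.
Context {R : realType} (k n : nat) (c : {posnum R}).
Local Notation S := (spider k n.+1 c).
Local Notation V := (vert S).
Local Notation adj := (@spider_edge k n.+1).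
Implicit Types (B C : {set V}) (i : 'I_k) (m t : nat).

(* The vertex of leg i at distance m from the center; inord makes it junk for
   m > n.+1. *)
Definition leg i m : V := if m is m'.+1 then Some (i, inord m') else None.

Lemma leg_some i (j : 'I_n.+1) : leg i j.+1 = Some (i, j).
Proof. by rewrite /leg inord_val. Qed.

Lemma spider_edge_sym (u v : V) :
  adj u v = adj v u.
Proof. by rewrite /spider_edge orbC. Qed.

Lemma spider_edge_leg i m : (m <= n)%N ->
  adj (leg i m) (leg i m.+1).
Proof.
case: m => [|m] mn; rewrite /spider_edge /=; first by rewrite inordK.
have mn1 : (m.+1 < n.+1)%N by [].
by rewrite (inordK mn1) (inordK (ltnW mn1)) !eqxx.
Qed.

Lemma spider_edge_to_leg (u : V) i m : (m <= n)%N ->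
  adj u (leg i m.+1) ->
  u = leg i m \/ (m < n)%N /\ u = leg i m.+2.
Proof.
move=> mn; case: u => [[i' j]|]; rewrite /spider_edge /= inordK //; last first.
  by rewrite orbF => /eqP ->; left.
case/orP => /andP[/eqP <- /eqP jm].
  by left; rewrite jm leg_some.
by right; rewrite -leg_some jm -ltnS -jm.
Qed.

Lemma blue_probE B (w : V) : w \notin B -> blue_prob B w =
  #|[pred u in B | adj u w]|%:R /
  #|[pred u | adj u w]|%:R.
Proof.
move=> /negbTE wB; rewrite /blue_prob wB.
have sumE (P : pred V) : \sum_(u | P u) weight u w =
    c%:num * #|[pred u | P u & adj u w]|%:R.
  by rewrite /= -big_mkcondr /= sumr_const mulr_natr.
rewrite !sumE; have c0 : 0 < c%:num by [].
rewrite -mulf_div divff ?gt_eqF // mul1r pmulr_rgt0 // ltr0n.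
(* For a vertex without neighbours, division by zero gives the value 0 that the definition
   prescribes. *)
by case: posnP => // ->; rewrite invr0 mulr0.
Qed.

(** [A] is any set containing the neighbours of [w], so exact degrees need not be computed: it will
    be the whole vertex set or a pair. *)
Lemma blue_prob_nbr_ge B (u w : V) (A : pred V) : u \in B -> w \notin B ->
  adj u w ->
  (forall x, adj x w -> A x) ->
  #|A|%:R^-1 <= blue_prob B w.
Proof.
move=> uB wB uw nbrA; rewrite blue_probE //.
have wu : (0 < #|[pred x | adj x w]|)%N.
  by apply/card_gt0P; exists u.
have wA : (#|[pred x | adj x w]| <= #|A|)%N.
  by apply/subset_leq_card/fintype.subsetP => x; apply: nbrA.
rewrite -[leLHS]mul1r ler_pM ?invr_ge0 //.
  by rewrite ler1n; apply/card_gt0P; exists u; rewrite inE uB.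
by rewrite lef_pV2 ?ler_nat // posrE ltr0n // (leq_trans wu).
Qed.

(** * Initial blue segments of legs *)

(** The blue segment is counted without the center. When nothing white is found, [find] returns the
    full length [n.+1]. *)
Definition prefix B i : nat := find (fun m => leg i m.+1 \notin B) (iota 0 n.+1).

Lemma prefix_le B i : (prefix B i <= n.+1)%N.
Proof. by rewrite -[leqRHS](size_iota 0) find_size. Qed.

Lemma leg_prefix B i m : None \in B -> (m <= prefix B i)%N -> leg i m \in B.
Proof.
case: m => [//|m] _ mp; have /negbFE := before_find 0%N mp.
by rewrite nth_iota ?add0n // (leq_trans mp) ?prefix_le.
Qed.

Lemma leg_prefixS B i : (prefix B i <= n)%N -> leg i (prefix B i).+1 \notin B.
Proof.
move=> pn; have hasw : has (fun m => leg i m.+1 \notin B) (iota 0 n.+1).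
  by rewrite has_find size_iota ltnS.
by have := nth_find 0%N hasw; rewrite -/(prefix B i) nth_iota ?add0n.
Qed.

Lemma leq_prefix B i m : (m <= n.+1)%N ->
  (forall l, (l < m)%N -> leg i l.+1 \in B) -> (m <= prefix B i)%N.
Proof.
move=> mn legB; rewrite leqNgt; apply/negP => pm.
have /negP := leg_prefixS _ _ (leq_trans pm mn).
by apply; apply: legB.
Qed.

Lemma prefix_sub B C i : None \in B -> B \subset C ->
  (prefix B i <= prefix C i)%N.
Proof.
move=> cB /fintype.subsetP BC; apply: leq_prefix; first exact: prefix_le.
by move=> l lp; apply/BC/leg_prefix.
Qed.

Lemma prefix_lt B C i : None \in B -> B \subset C -> (prefix B i <= n)%N ->
  leg i (prefix B i).+1 \in C -> (prefix B i < prefix C i)%N.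
Proof.
move=> cB /fintype.subsetP BC pn pC; apply: leq_prefix => // l.
by rewrite ltnS leq_eqVlt => /predU1P[->//|lp]; apply/BC/leg_prefix.
Qed.

(** If the center is blue, an unfinished leg has a white vertex right after its prefix. If it is
    white, the innermost blue vertex of the leg of [v] has a white inner neighbour. *)
Lemma spider_frontier (v : V) B : v \in B -> B != [set: V]%SET ->
  exists i m, [/\ (m <= n)%N, leg i m \in B & leg i m.+1 \notin B] \/
    [/\ (m <= n)%N, leg i m \notin B & leg i m.+1 \in B].
Proof.
move=> vB nB; have [cB|cB] := boolP ((None : V) \in B).
  have [w wB] : exists w, w \notin B.
    by apply/existsP; apply: contraNT nB => /existsPn all_B; apply/eqP/setP => w;
      have := all_B w; rewrite negbK finset.in_setT.
  case: w wB => [[i j]|]; last by rewrite cB.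
  rewrite -leg_some => wB; exists i, (prefix B i); left.
  have pn : (prefix B i <= n)%N.
    rewrite leqNgt; apply: contra wB => np; apply: leg_prefix => //.
    exact: leq_trans (ltn_ord j) np.
  by split; [|apply: leg_prefix|apply: leg_prefixS].
case: v vB => [[i j]|]; last by rewrite (negbTE cB).
rewrite -leg_some => vB.
have blue_leg : exists m, leg i m \in B by exists j.+1.
case: (ex_minnP blue_leg) => -[|m] mB min_m; first by rewrite mB in cB.
exists i, m; right; split=> //; first by rewrite -ltnS (leq_trans (min_m _ vB)).
by apply/negP => /min_m; rewrite ltnn.
Qed.

Lemma spider_tail_geometric (v : V) t :
  rzf_tail [set v]%SET t <= (1 - (#|V|%:R : R)^-1 / 2) ^+ t * 2 ^+ #|V|.
Proof.
apply: (rzf_tail_geometric v); last by rewrite inE.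
  have V0 : (0 < #|V|)%N by apply/card_gt0P; exists v.
  by rewrite invr_ge0 ler0n invf_le1 ?ler1n ?ltr0n.
move=> C vC nC; have [i [m [[mn uC wC]|[mn wC uC]]]] := spider_frontier v C vC nC.
  by exists (leg i m.+1) => //; apply: (blue_prob_nbr_ge _ _ _ _ uC wC) => //;
    exact: spider_edge_leg.
exists (leg i m) => //; apply: (blue_prob_nbr_ge _ _ _ _ uC wC) => //.
by rewrite spider_edge_sym spider_edge_leg.
Qed.

(** * Exponential potential for the start at the center *)

Lemma blue_prob_prefix B i : None \in B -> (prefix B i <= n)%N ->
  2^-1 <= blue_prob B (leg i (prefix B i).+1).
Proof.
move=> cB pn; set m := prefix B i.
apply: (@le_trans _ _ (#|pred2 (leg i m) (leg i m.+2)|%:R^-1)).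
  rewrite lef_pV2 ?posrE ?ltr0n ?ler_nat ?card2 //.
  by case: (_ != _).
apply: (@blue_prob_nbr_ge _ (leg i m)).
- exact: leg_prefix.
- exact: leg_prefixS.
- exact: spider_edge_leg.
- by move=> x /(spider_edge_to_leg _ _ _ pn)[->|[_ ->]]; rewrite /= eqxx ?orbT.
Qed.

(** A finished leg counts 0 rather than a^0 = 1, so that the contraction holds for it as well. *)
Definition leg_potential (a : R) B i : R :=
  if (prefix B i <= n)%N then a ^+ (n.+1 - prefix B i) else 0.

Lemma leg_potential_ge0 a B i : 0 <= a -> 0 <= leg_potential a B i.
Proof. by move=> a0; rewrite /leg_potential; case: ifP => // _; exact: exprn_ge0. Qed.

Lemma leg_potential_le a B i m : 1 <= a -> (m <= prefix B i)%N ->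
  leg_potential a B i <= a ^+ (n.+1 - m).
Proof.
move=> a1 mp; rewrite /leg_potential; case: ifP => _.
  by apply: ler_weXn2l => //; exact: leq_sub2l.
by apply: exprn_ge0; exact: le_trans a1.
Qed.

(** With probability at least 1/2 the prefix grows, which divides the potential by at least [a];
    otherwise the potential does not increase. *)
Lemma leg_potential_step a B i : 1 <= a -> None \in B ->
  \sum_C rzf_step B C * leg_potential a C i <=
    (1 + a^-1) / 2 * leg_potential a B i.
Proof.
move=> a1 cB; have a0 : 0 < a by exact: lt_le_trans a1.
have [pn|np] := leqP (prefix B i) n; last first.
  rewrite {2}/leg_potential leqNgt np mulr0 big1 // => C _.
  have [->|step] := eqVneq (rzf_step B C) 0; first by rewrite mul0r.
  rewrite /leg_potential leqNgt (leq_trans np) ?mulr0 //.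
  exact: prefix_sub (rzf_step_neq0_sub _ _ step).
pose y := a ^+ (n - prefix B i).
have y0 : 0 <= y by apply: exprn_ge0; exact: ltW.
have potE : leg_potential a B i = a * y by rewrite /leg_potential pn subSn // exprS.
have half : (1 + a^-1) / 2 * leg_potential a B i = a * y - 2^-1 * (a * y - y).
  by rewrite potE; field; rewrite gt_eqF.
apply: (@le_trans _ _ (a * y -
    blue_prob B (leg i (prefix B i).+1) * (a * y - y))); last first.
  rewrite half lerD2l lerN2 ler_wpM2r ?blue_prob_prefix // subr_ge0.
  by rewrite ler_peMl.
apply: rzf_step_mean_le => C step.
  move=> _; rewrite /y -exprS -subSn //; apply: leg_potential_le => //.
  exact: prefix_sub (rzf_step_neq0_sub _ _ step).
move=> wC; rewrite /y -subSS; apply: leg_potential_le => //.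
exact: prefix_lt (rzf_step_neq0_sub _ _ step) _ wC.
Qed.

(** The potentials of the legs are summed, so linearity of the mean suffices. An unfinished leg
    alone contributes at least 1, and each leg starts with at most [a ^+ n.+1]. *)
Lemma center_tail_le (a : R) t : 1 <= a ->
  rzf_tail [set (None : V)]%SET t <= ((1 + a^-1) / 2) ^+ t * (k%:R * a ^+ n.+1).
Proof.
move=> a1; have a0 : 0 <= a by exact: le_trans a1.
have r0 : 0 <= (1 + a^-1) / 2 by rewrite divr_ge0 // addr_ge0 // invr_ge0.
apply: (@le_trans _ _ (((1 + a^-1) / 2) ^+ t *
    \sum_(i < k) leg_potential a [set None]%SET i)); last first.
  apply: ler_wpM2l; first exact: exprn_ge0.
  rewrite mulr_natl -[k in _ *+ k]card_ord -sumr_const; apply: ler_sum => i _.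
  by rewrite -[n.+1 in leRHS]subn0; exact: leg_potential_le.
apply: (@rzf_tail_decay _ S None (fun C => \sum_(i < k) leg_potential a C i)) => //.
- by move=> C; apply: sumr_ge0 => i _; exact: leg_potential_ge0.
- move=> C cC nC; have [i pn] : exists i, (prefix C i <= n)%N.
    apply: contrapT => full; move: nC; apply/negP; rewrite negbK; apply/eqP/setP.
    case=> [[i j]|]; rewrite finset.in_setT // -leg_some; apply: leg_prefix => //.
    have [pn|np] := leqP (prefix C i) n; first by case: full; exists i.
    exact: leq_trans (ltn_ord j) np.
  rewrite (bigD1 i) //= -[leLHS]addr0; apply: lerD.
    by rewrite /leg_potential pn exprn_ege1.
  by apply: sumr_ge0 => l _; exact: leg_potential_ge0.
- move=> C cC _; under eq_bigr do rewrite mulr_sumr.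
  rewrite exchange_big mulr_sumr /=; apply: ler_sum => i _.
  exact: leg_potential_step.
- by rewrite inE.
Qed.

(** * Lower bound: the farthest blue vertex of an initially white leg *)

(** Distance to the center, with gaps allowed below; it is 0 when the leg is white, whatever the
    colour of the center. *)
Definition farthest B i : nat := \max_(j < n.+1 | Some (i, j) \in B) j.+1.

Lemma farthest_ge B i m : (m <= n)%N -> leg i m.+1 \in B -> (m < farthest B i)%N.
Proof.
move=> mn mB; have mn1 : (m < n.+1)%N by [].
rewrite -[m in (m < _)%N](inordK mn1).
exact: (@leq_bigmax_cond _ _ (fun j : 'I_n.+1 => j.+1) (inord m)).
Qed.

Lemma farthest_step B C i : rzf_step B C != 0 ->
  (farthest C i <= (farthest B i).+1)%N.
Proof.
move=> step; apply/bigmax_leqP => j; rewrite -leg_some => jC.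
have jn : (j <= n)%N by rewrite -ltnS.
have [jB|jB] := boolP (leg i j.+1 \in B).
  exact: leqW (farthest_ge _ _ _ jn jB).
have [u uB] := rzf_step_neq0_adj _ _ _ step jC jB.
rewrite /= /spider_weight; case: ifP => [uj _|]; last by rewrite eqxx.
have [uE|[jn' uE]] := spider_edge_to_leg _ _ _ jn uj; last first.
  by rewrite uE in uB; have := farthest_ge _ _ _ jn' uB; lia.
case: (nat_of_ord j) jn uE => [//|l] ln uE; rewrite uE in uB.
by have := farthest_ge _ _ _ (ltnW ln) uB; lia.
Qed.

(** The next vertex has two neighbours, and the outer one is white. The hypothesis excludes the last
    vertex of the leg, which has a single neighbour and can be forced. *)
Lemma blue_prob_farthest B i : (farthest B i < n)%N ->
  blue_prob B (leg i (farthest B i).+1) <= 2^-1.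
Proof.
set m := farthest B i => mn.
have white l : (m <= l <= n)%N -> leg i l.+1 \notin B.
  move=> /andP[ml ln]; apply/negP => /(farthest_ge _ _ _ ln).
  by rewrite ltnNge ml.
have wB : leg i m.+1 \notin B by apply: white; rewrite leqnn ltnW.
rewrite blue_probE // ler_pdivrMr; last first.
  rewrite ltr0n; apply/card_gt0P; exists (leg i m).
  by rewrite inE; apply: spider_edge_leg; exact: ltnW.
rewrite mulrC ler_pdivlMr // -natrM ler_nat.
apply: (@leq_trans (1 * 2)).
  apply: leq_mul => //; rewrite -(card1 (leg i m)).
  apply/subset_leq_card/fintype.subsetP => u; rewrite !inE => /andP[uB um].
  have [-> //|[_ uE]] := spider_edge_to_leg _ _ _ (ltnW mn) um.
  by rewrite uE (negbTE (white m.+1 _)) // leqnSn in uB.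
have <- : #|pred2 (leg i m) (leg i m.+2)| = 2%N.
  rewrite card2; suff -> : leg i m != leg i m.+2 by [].
  apply/negP; case: (m) mn => [//|l] ln /eqP [] /(congr1 val) /=.
  by rewrite !inordK; lia.
rewrite mul1n; apply/subset_leq_card/fintype.subsetP => u.
rewrite !inE => /pred2P[]->.
  by apply: spider_edge_leg; exact: ltnW.
by rewrite spider_edge_sym spider_edge_leg.
Qed.

Lemma ept_rzf_from_spider_ge (v : V) : (1 < k)%N ->
  ((2 * n)%:R%:E <= ept_rzf_from v)%E.
Proof.
move=> k1.
have [i vi] : exists i, forall j, v <> Some (i, j).
  case: v => [[i j]|]; last by exists (Ordinal (ltnW k1)).
  have [i0|i0] := eqVneq (i : nat) 0%N.
    by exists (Ordinal k1) => j' [ii _]; rewrite ii in i0.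
  by exists (Ordinal (ltnW k1)) => j' [ii _]; rewrite ii eqxx in i0.
(* Truncated subtraction makes [h] vanish once distance [n] is reached, where the bound 1/2 no
   longer applies. *)
pose h B : R := (2 * (n - farthest B i))%:R.
have hv : h [set v]%SET = (2 * n)%:R.
  rewrite /h /farthest big_pred0 ?subn0 // => j; rewrite inE.
  by apply/eqP => vj; apply: (vi j).
rewrite -hv; set q := (#|V|%:R : R)^-1.
have V0 : (0 < #|V|)%N by apply/card_gt0P; exists v.
have q0 : 0 < q by rewrite invr_gt0 ltr0n.
have q1 : q <= 1 by rewrite invf_le1 ?ler1n ?ltr0n.
apply: (@ept_rzf_from_ge _ _ v h (2 * n)%:R (1 - q / 2) (2 ^+ #|V|)).
- by lra.
- by move=> t; exact: spider_tail_geometric.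
- by move=> C; rewrite ler_nat leq_mul2l leq_subr.
- have full : (n < farthest [set: V]%SET i)%N by apply: farthest_ge; rewrite ?inE.
  by rewrite /h (eqP (ltnW full : n - _ == 0)%N) muln0.
move=> C nC; have [nf|fn] := leqP n (farthest C i).
  apply: (@le_trans _ _ 0).
    by rewrite /h (eqP (nf : n - _ == 0)%N) muln0 sub0r oppr_le0.
  by apply: sumr_ge0 => D _; apply: mulr_ge0 => //; exact: rzf_step_ge0.
have hD D : (farthest D i <= (farthest C i).+1)%N -> h C - 2 <= h D.
  by move=> ?; rewrite lerBlDr -natrD ler_nat; lia.
have stepD D (step : rzf_step C D != 0) := farthest_step _ _ i step.
(* [rzf_step_mean_le] bounds means from above, hence the passage to [- h]: it rises by at most 2 if
   the next vertex turns blue, and not at all otherwise. *)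
have -> : \sum_D rzf_step C D * h D = - \sum_D rzf_step C D * (- h D).
  by rewrite -sumrN; apply: eq_bigr => D _; rewrite mulrN opprK.
rewrite lerNr; apply: (@le_trans _ _ (- h C -
    blue_prob C (leg i (farthest C i).+1) * (- h C - (2 - h C)))).
  apply: rzf_step_mean_le => D step.
    move=> wD; rewrite lerN2 ler_nat leq_mul2l leq_sub2l //=.
    apply/bigmax_leqP => j; rewrite -leg_some => jD.
    have jn : (j <= n)%N by rewrite -ltnS.
    have := leq_trans (farthest_ge _ _ _ jn jD) (stepD D step).
    rewrite ltnS leq_eqVlt => /predU1P[jE|//].
    by rewrite -jE jD in wD.
  by move=> _; rewrite lerNl opprB; apply: hD; exact: stepD.
by have := blue_prob_farthest _ _ fn; lra.
Qed.

(** About [2 * (1 + d) * n.+1] rounds contribute at most 1 each to the tail sum. Afterwards the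
    tails are dominated by [k] times a geometric series of ratio [1 - d / (2 * (1 + d))], which
    gives the last term. *)
Lemma ept_rzf_from_center_le (d : R) : 0 < d ->
  (ept_rzf_from (None : V) <=
    (2 * (1 + d) * n.+1%:R + 1 + k%:R * (2 * (1 + d) / d))%:E)%E.
Proof.
move=> d0; pose a := 1 + d; pose r := (1 + a^-1) / 2.
have a0 : 0 < a by rewrite /a; lra.
have a1 : 1 <= a by rewrite /a; lra.
have rE : 1 - r = d / (2 * a) by rewrite /r /a; field; rewrite gt_eqF.
have r1 : 0 < 1 - r by rewrite rE divr_gt0 // mulr_gt0.
have r0 : 0 <= r by rewrite divr_ge0 // addr_ge0 // invr_ge0 ltW.
pose x := 2 * a * n.+1%:R.
have x0 : 0 <= x by rewrite !mulr_ge0 // ltW.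
have /andP[tx xt] := truncn_itv x0; set t0 := (Num.truncn x).+1 in xt.
have t0x : t0%:R <= x + 1 by rewrite -natr1 lerD2r.
(* With r = 1 - d / (2 * a) <= exp (- d / (2 * a)) and a <= exp d, the decay
   r ^+ t0 beats a ^+ n.+1 as soon as t0 >= 2 * a * n.+1. *)
have decay : a ^+ n.+1 * r ^+ t0 <= 1.
  apply: (@le_trans _ _ (expR d ^+ n.+1 * expR (- (1 - r)) ^+ t0)).
    apply: ler_pM; rewrite ?exprn_ge0 // ?(ltW a0) //.
      by apply: lerXn2r; rewrite ?nnegrE ?expR_ge0 ?(ltW a0) ?expR_ge1Dx.
    apply: lerXn2r; rewrite ?nnegrE ?expR_ge0 //.
    by apply: le_trans (expR_ge1Dx _); lra.
  rewrite -!expRM_natl -expRD -[leRHS]expR0 ler_expR rE.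
  have : 0 <= (t0%:R - x) * (d / (2 * a)).
    by rewrite mulr_ge0 ?divr_ge0 ?mulr_ge0 ?subr_ge0 ?(ltW a0) ?(ltW d0) ?(ltW xt).
  rewrite mulrBl [x * _](_ : _ = n.+1%:R * d); first by lra.
  by rewrite /x; field; rewrite gt_eqF.
apply: ept_rzf_from_le => T; rewrite -/a -/x.
(* Lengthening the sum allows it to be split at [t0] for every [T]. *)
apply: (@le_trans _ _ (\sum_(t < t0 + T) rzf_tail [set (None : V)]%SET t)).
  rewrite addnC big_split_ord lerDl; apply: sumr_ge0 => t _.
  exact: rzf_tail_ge0.
rewrite big_split_ord; apply: lerD.
  apply: le_trans t0x; rewrite -[t0 in leRHS]card_ord -sumr_const.
  by apply: ler_sum => t _; exact: rzf_tail_le1.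
apply: (@le_trans _ _ (\sum_(t < T) k%:R * r ^+ t)).
  apply: ler_sum => t _; apply: le_trans (center_tail_le _ _ a1) _.
  rewrite -/r exprD -mulrA [r ^+ t * _]mulrC mulrA [r ^+ t0 * _]mulrC.
  apply: ler_wpM2r; first exact: exprn_ge0.
  by rewrite -mulrA ler_piMr.
rewrite -mulr_sumr; apply: ler_wpM2l => //.
rewrite -[leRHS]invf_div -rE -[leRHS]mul1r ler_pdivlMr //.
have := subrX1 r T; have := exprn_ge0 T r0; lra.
Qed.

End Spider.

(** * Two-sided bounds and the asymptotics *)

Lemma ept_rzf_spider_bounds (R : realType) (k n : nat) (c : {posnum R}) (d : R) :
  (1 < k)%N -> 0 < d -> (0 < n)%N ->
  exists2 x : R, ept_rzf (spider k n c) = x%:E &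
    2 * n%:R - 2 <= x <= 2 * (1 + d) * n%:R + 1 + k%:R * (2 * (1 + d) / d).
Proof.
case: n => // n k1 d0 _.
have upper : (ept_rzf (spider k n.+1 c) <=
    (2 * (1 + d) * n.+1%:R + 1 + k%:R * (2 * (1 + d) / d))%:E)%E.
  apply: le_trans (ept_rzf_from_center_le k n c _ d0).
  exact: (@bigmin_le _ (\bar R)).
have lower : ((2 * n)%:R%:E <= ept_rzf (spider k n.+1 c))%E.
  apply: (@le_bigmin _ (\bar R)) => [|v _]; first exact: leey.
  exact: ept_rzf_from_spider_ge.
case: (ept_rzf _) upper lower => // x; rewrite !lee_fin => upper lower.
exists x => //; rewrite upper andbT (le_trans _ lower) // natrM -natr1; lra.
Qed.

Theorem theorem3p2 (R : realType) (k : nat) (hk : (1 < k)%N)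
    (c : nat -> {posnum R}) :
  exists eps : nat -> R,
    eps @ \oo --> (0 : R) /\
    forall n : nat, (0 < n)%N ->
      ept_rzf (spider k n (c n)) = (2 * n%:R * (1 + eps n))%:E.
Proof.
exists (fun n => fine (ept_rzf (spider k n (c n))) / (2 * n%:R) - 1); split.
  apply/cvgrPdist_le => e e0; have d0 : 0 < e / 2 by lra.
  (* With [d = e / 2], the upper bound gives [eps n <= e / 2 + M / (2 * n)], at most [e] once
     [n >= M / e]. The lower bound gives [eps n >= - 1 / n], at least [- e] once [n >= 1 / e]. *)
  pose M := 1 + k%:R * (2 * (1 + e / 2) / (e / 2)).
  near=> n.
  have n0 : (0 < n)%N by near: n; exact: nbhs_infty_gt.
  have [x -> /= /andP[lx ux]] := ept_rzf_spider_bounds R k n (c n) _ hk d0 n0.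
  have ne : 1 / e <= n%:R by near: n; exact: nbhs_infty_ger.
  have nM : M / e <= n%:R by near: n; exact: nbhs_infty_ger.
  rewrite ler_pdivrMr // in ne; rewrite ler_pdivrMr // in nM.
  have n0' : 0 < 2 * n%:R :> R by rewrite mulr_gt0 // ltr0n.
  rewrite sub0r normrN ler_norml lerBrDr lerBlDr ler_pdivlMr // ler_pdivrMr //.
  by apply/andP; split; move: lx ux nM; rewrite -addrA -/M; lra.
move=> n n0; have [x -> _] := ept_rzf_spider_bounds R k n (c n) _ hk ltr01 n0.
congr (_%:E) => /=; field.
by rewrite pnatr_eq0 -lt0n.
Unshelve. all: by end_near.
Qed.
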